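(* Let $N\ge 4$ be an integer, let $p\in\mathbb{Z}\setminus\{0,1,-1\}$ with $p/N,(p+1)/N,(p-1)/N\notin\mathbb{Z}$, let $a,b\in\mathbb{R}$ with $ab\neq0$, and let $q_k(t)$, $k=0,\dots,N-1$, be the $N$-body choreographic motion on the $p$-limaçon curve $q(t)=a(\cos t,\sin t)+b(\cos pt,\sin pt)$. Then for every integer $\ell$ the following quantities are independent of $t$ and have the indicated values: $$\sum_{k=0}^{N-1} q_k\cdot q_{k+\ell}=N\left(a^2\cos\frac{2\pi\ell}{N}+b^2\cos\frac{2\pi p\ell}{N}\right),$$ $$\sum_{k=0}^{N-1} q_k\times q_{k+\ell}=N\left(a^2\sin\frac{2\pi\ell}{N}+b^2\sin\frac{2\pi p\ell}{N}\right),$$ $$v_\ell^{\pm}:=\sum_{k=0}^{N-1}|q_k\pm q_{k+\ell}|^2=2N\left(a^2\left(1\pm\cos\frac{2\pi\ell}{N}\right)+b^2\left(1\pm\cos\frac{2\pi p\ell}{N}\right)\right).$$ Moreover, for $Z_N$-symmetric force coefficients, the potential energy $V=\frac12\sum_{j<l}\kappa_{jl}|q_j-q_l|^2$ equals $\frac12\sum_{\ell=1}^{\lfloor N/2\rfloor}\kappa_\ell V_\ell$, where $V_\ell=v_\ell^-$ for $1\le\ell\le\lfloor N/2\rfloor-1$, and $V_{\lfloor N/2\rfloor}=v^-_{\lfloor N/2\rfloor}$ for odd $N$, $V_{N/2}=\frac12 v^-_{N/2}$ for even $N$.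
   Context: The $N$-body choreographic motion is $q_k(t)=q\left(t+\frac{2\pi k}{N}\right)\in\mathbb{R}^2$, with indices $k$ read modulo $N$. For $u=(u_1,u_2),v=(v_1,v_2)\in\mathbb{R}^2$, $u\cdot v$ is the Euclidean inner product and $u\times v=u_1v_2-u_2v_1$. Force coefficients $\kappa_{jl}=\kappa_{lj}\in\mathbb{R}$ are $Z_N$-symmetric if, for $j\ne l$, $\kappa_{jl}=\kappa_d$ with $d=\min(|j-l|,N-|j-l|)\in\{1,\dots,\lfloor N/2\rfloor\}$. *)

(* Defs.v *)
From HB Require Import structures.
From mathcomp Require Import all_boot all_order all_algebra.
From mathcomp Require Import boolp classical_sets reals topology normedtype trigo.
Set Implicit Arguments.
Unset Strict Implicit.
Unset Printing Implicit Defensive.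
Import Order.TTheory GRing.Theory Num.Theory.
Local Open Scope ring_scope.

Definition vec2 (R : realType) (x y : R) : 'rV[R]_2 :=
  \row_(i < 2) (if i == 0 then x else y).

Definition dot (R : realType) (u v : 'rV[R]_2) : R :=
  \sum_(i < 2) u 0 i * v 0 i.

Definition cross (R : realType) (u v : 'rV[R]_2) : R :=
  u 0 0 * v 0 1 - u 0 1 * v 0 0.

(* The canonical norm on 'rV[R]_2 is the sup norm, hence this definition. *)
Definition enorm (R : realType) (u : 'rV[R]_2) : R := Num.sqrt (dot u u).

Definition limacon (R : realType) (p : int) (a b : R) (t : R) : 'rV[R]_2 :=
  a *: vec2 (cos t) (sin t) + b *: vec2 (cos (p%:~R * t)) (sin (p%:~R * t)).

(* The index k ranges over the integers and is read modulo N: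
   (k %% N)%Z is the representative of k in {0, ..., N-1}. *)
Definition body (R : realType) (N : nat) (q : R -> 'rV[R]_2) (k : int) (t : R) :
    'rV[R]_2 :=
  q (t + 2 * pi * (k %% N)%Z%:~R / N%:R).

Definition vplus (R : realType) (N : nat) (q : R -> 'rV[R]_2) (l : int) (t : R) : R :=
  \sum_(k < N) enorm (body N q k t + body N q (k%:Z + l) t) ^+ 2.

Definition vminus (R : realType) (N : nat) (q : R -> 'rV[R]_2) (l : int) (t : R) : R :=
  \sum_(k < N) enorm (body N q k t - body N q (k%:Z + l) t) ^+ 2.

Definition circ_dist (N j l : nat) : nat :=
  minn `|j%:Z - l%:Z|%N (N - `|j%:Z - l%:Z|%N).

(* kd d is the common value of the coefficients at circular distance d; only
   its values for 1 <= d <= N./2 are constrained. The diagonal of kappa is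
   irrelevant. *)
Definition ZN_symmetric (R : realType) (N : nat) (kappa : 'I_N -> 'I_N -> R)
    (kd : nat -> R) : Prop :=
  (forall j l : 'I_N, kappa j l = kappa l j) /\
  (forall j l : 'I_N, j != l -> kappa j l = kd (circ_dist N j l)).

Definition potential (R : realType) (N : nat) (kappa : 'I_N -> 'I_N -> R)
    (q : R -> 'rV[R]_2) (t : R) : R :=
  2^-1 * \sum_(j < N) \sum_(l < N | (j < l)%N)
           kappa j l * enorm (body N q j t - body N q l t) ^+ 2.

(* For even N, each pair at distance N./2 occurs twice in vminus. *)
Definition Vshell (R : realType) (N : nat) (q : R -> 'rV[R]_2) (l : nat) (t : R) : R :=
  if ~~ odd N && (l == N./2) then 2^-1 * vminus N q l t else vminus N q l t.

(* Main.v *)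
Require Import Defs.
From HB Require Import structures.
From mathcomp Require Import all_boot all_order all_algebra.
From mathcomp Require Import boolp classical_sets reals topology normedtype trigo.
From mathcomp Require Import ring lra zify.
Set Implicit Arguments.
Unset Strict Implicit.
Unset Printing Implicit Defensive.
Import Order.TTheory GRing.Theory Num.Theory.
Local Open Scope ring_scope.

(** Put s_k = t + 2 pi k / N. A point of the limacon is a sum of two uniformly
    rotating vectors, of angular velocities 1 and p, so the product (dot or
    cross) of q(s) and q(s + x) has four terms. The two terms pairing equal
    velocities do not depend on s: they give a^2 cos x + b^2 cos (p x), or the
    same with sines. The two mixed terms, with coefficient a b, are a cosine or
    sine of an angle c + (p - 1) s ([dot_limacon], [cross_limacon]). Summed over
    s = s_k, a mixed term is the real or imaginary part of a multiple of the sum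
    of the powers of exp (2 pi i (p - 1) / N). As (p - 1) / N is not an integer,
    this root of unity is not 1 and the sum vanishes ([sum_cos_roots_unity],
    [sum_sin_roots_unity]). The values of v_l^+ and v_l^- follow by expanding
    the squares.

    The formula for the potential energy holds for every choreography
    ([potential_shells]): twice the sum over pairs j < l is the sum over ordered
    pairs of distinct bodies, which is grouped by the difference m = l - j
    modulo N. The group m contributes kappa_min(m, N - m) v_m^-, which is
    invariant under m -> N - m, so m = 1, ..., N - 1 folds onto 1, ..., N/2;
    when N is even the fixed point m = N/2 is met only once, whence the factor
    1/2 in the last shell. *)

(** * Periodicity, and the zeros of the sine *)

Lemma periodic_int (R : realType) (f : R -> R) (T : R) :
  periodic f T -> forall (z : int) x, f (x + T * z%:~R) = f x.
Proof.
move=> fT [n|n] x; first by rewrite -pmulrn mulr_natr periodicn.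
(* The natural case is applied at the point x - T (n + 1). *)
rewrite NegzE mulrNz mulrN -pmulrn mulr_natr.
by rewrite -[LHS](periodicn fT n.+1) subrK.
Qed.

Lemma cosD2piz (R : realType) (x : R) (z : int) :
  cos (x + 2 * pi * z%:~R) = cos x.
Proof. by rewrite mulr_natl (periodic_int (@cosD2pi R)). Qed.

Lemma sinD2piz (R : realType) (x : R) (z : int) :
  sin (x + 2 * pi * z%:~R) = sin x.
Proof. by rewrite mulr_natl (periodic_int (@sinD2pi R)). Qed.

Lemma sin_piz (R : realType) (z : int) : sin (pi * z%:~R : R) = 0.
Proof.
have sin_pin n : sin (pi * n%:R : R) = 0.
  elim: n => [|n IHn]; first by rewrite mulr0 sin0.
  by rewrite -natr1 mulrDr mulr1 sinDpi IHn oppr0.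
by case: z => n; rewrite ?NegzE ?mulrNz ?mulrN ?sinN -pmulrn sin_pin ?oppr0.
Qed.

(** The fractional part r of y satisfies sin (pi r) = 0 as well, while the sine
    is positive on the open interval from 0 to pi, so r = 0. *)
Lemma sin_pi_eq0_int (R : realType) (y : R) :
  sin (pi * y) = 0 -> y \is a Num.int.
Proof.
move=> siny0; rewrite intrEfloor eq_le floor_le /= leNgt; apply/negP => ltfy.
have : 0 < sin (pi * (y - (Num.floor y)%:~R)).
  have := pi_gt0 R; have := floorD1_gt y; rewrite intrD => lty1 pi_gt0.
  apply: sin_gt0_pi; nra.
by rewrite mulrBr sinB siny0 sin_piz mul0r mulr0 subrr ltxx.
Qed.

(** * Trigonometric sums over the N-th roots of unity *)

(** Multiplying by 2 sin (x / 2) turns each cosine into a difference of sines at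
    successive half-integer multiples of x, and the sum telescopes. *)
Lemma sum_cos_progression (R : realType) (N : nat) (c x : R) :
  2 * sin (x / 2) * \sum_(k < N) cos (c + x * k%:R)
    = sin (c + x * N%:R - x / 2) - sin (c - x / 2).
Proof.
rewrite -(big_mkord xpredT (fun k => cos (c + x * k%:R))) big_distrr /=.
pose F k : R := sin (c + x * k%:R - x / 2).
rewrite (_ : c - x / 2 = c + x * 0%:R - x / 2); last by rewrite mulr0 addr0.
rewrite -[RHS](@telescope_sumr _ 0 N F) //; apply: eq_bigr => k _.
rewrite /F (_ : _ + _ * k.+1%:R - _ = c + x * k%:R + x / 2); last by field.
by rewrite sinB sinD; ring.
Qed.

(** With common difference x = 2 pi m / N, the two boundary terms of the
    telescoped sum differ by the angle N x = 2 pi m and cancel; the factor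
    sin (x / 2) = sin (pi m / N) is nonzero because m / N is not an integer. *)
Lemma sum_cos_roots_unity (R : realType) (N : nat) (m : int) (c : R) :
  (0 < N)%N -> m%:Q / N%:Q \isn't a Num.int ->
  \sum_(k < N) cos (c + 2 * pi * m%:~R / N%:R * k%:R) = 0.
Proof.
move=> N_gt0 mN.
have N0 : N%:R != 0 :> R by rewrite pnatr_eq0 -lt0n.
have := sum_cos_progression N c (2 * pi * m%:~R / N%:R).
rewrite mulfVK // (addrAC c) sinD2piz subrr.
rewrite (_ : _ / N%:R / 2 = pi * (m%:~R / N%:R)); last by field.
move/eqP; rewrite !mulf_eq0 pnatr_eq0 /= => /orP[/eqP/sin_pi_eq0_int|/eqP//].
case/intrP => z mNz; case/negP: mN; apply/intrP; exists z.
have NQ0 : N%:Q != 0 by rewrite intr_eq0 -lt0n.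
apply: (mulIf NQ0); rewrite divfK // -intrM; congr (_%:~R).
apply: (@intr_inj R); rewrite intrM -mNz -pmulrn divfK //.
Qed.

Lemma sum_sin_roots_unity (R : realType) (N : nat) (m : int) (c : R) :
  (0 < N)%N -> m%:Q / N%:Q \isn't a Num.int ->
  \sum_(k < N) sin (c + 2 * pi * m%:~R / N%:R * k%:R) = 0.
Proof.
move=> N_gt0 mN; rewrite -[RHS](sum_cos_roots_unity (c - pi / 2) N_gt0 mN).
by apply: eq_bigr => k _; rewrite addrAC cosBpihalf.
Qed.

(** * Dot and cross products along the limacon *)

Lemma limacon2pi (R : realType) (p : int) (a b t : R) (z : int) :
  limacon p a b (t + 2 * pi * z%:~R) = limacon p a b t.
Proof.
rewrite /limacon cosD2piz sinD2piz mulrDr.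
rewrite (_ : p%:~R * (2 * pi * _) = 2 * pi * (p * z)%:~R); last first.
  by rewrite intrM; ring.
by rewrite cosD2piz sinD2piz.
Qed.

(** The curve has period 2 pi, so reducing the index modulo N does not move the
    point. *)
Lemma body_limacon (R : realType) (N : nat) (p : int) (a b t : R) (k : int) :
  (0 < N)%N ->
  body N (limacon p a b) k t = limacon p a b (t + 2 * pi * k%:~R / N%:R).
Proof.
move=> N_gt0; have N0 : N%:R != 0 :> R by rewrite pnatr_eq0 -lt0n.
rewrite /body -[LHS](limacon2pi _ _ _ _ (k %/ N)%Z); congr limacon.
rewrite [in RHS](divz_eq k N) (intrD R (_ * _)) intrM -[N%:~R]pmulrn.
by field.
Qed.

Lemma dotE (R : realType) (u v : 'rV[R]_2) :
  dot u v = u 0 0 * v 0 0 + u 0 1 * v 0 1.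
Proof.
rewrite /dot !big_ord_recl big_ord0 addr0.
by congr (_ + u _ _ * v _ _); apply: val_inj.
Qed.

Lemma dotC (R : realType) (u v : 'rV[R]_2) : dot u v = dot v u.
Proof. by rewrite !dotE ![v 0 _ * _]mulrC. Qed.

Lemma limacon0 (R : realType) (p : int) (a b t : R) :
  limacon p a b t 0 0 = a * cos t + b * cos (p%:~R * t).
Proof. by rewrite !mxE. Qed.

Lemma limacon1 (R : realType) (p : int) (a b t : R) :
  limacon p a b t 0 1 = a * sin t + b * sin (p%:~R * t).
Proof. by rewrite !mxE. Qed.

(** The mixed terms are cos (p s - (s + x)) and cos (p (s + x) - s): both have
    angular velocity p - 1 in s. *)
Lemma dot_limacon (R : realType) (p : int) (a b s x : R) :
  dot (limacon p a b s) (limacon p a b (s + x))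
  = a ^+ 2 * cos x + b ^+ 2 * cos (p%:~R * x)
    + a * b * (cos (- x + (p - 1)%:~R * s)
               + cos (p%:~R * x + (p - 1)%:~R * s)).
Proof.
rewrite dotE !limacon0 !limacon1 intrB.
rewrite (_ : - x + _ = p%:~R * s - (s + x)); last by ring.
rewrite (_ : p%:~R * x + _ = p%:~R * (s + x) - s); last by ring.
rewrite [in a ^+ 2 * _](_ : x = (s + x) - s); last by ring.
rewrite [in b ^+ 2 * _](_ : p%:~R * x = p%:~R * (s + x) - p%:~R * s); last by ring.
by rewrite !cosB; ring.
Qed.

Lemma cross_limacon (R : realType) (p : int) (a b s x : R) :
  cross (limacon p a b s) (limacon p a b (s + x))
  = a ^+ 2 * sin x + b ^+ 2 * sin (p%:~R * x)
    + a * b * (sin (p%:~R * x + (p - 1)%:~R * s)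
               - sin (- x + (p - 1)%:~R * s)).
Proof.
rewrite /cross !limacon0 !limacon1 intrB.
rewrite (_ : - x + _ = p%:~R * s - (s + x)); last by ring.
rewrite (_ : p%:~R * x + _ = p%:~R * (s + x) - s); last by ring.
rewrite [in a ^+ 2 * _](_ : x = (s + x) - s); last by ring.
rewrite [in b ^+ 2 * _](_ : p%:~R * x = p%:~R * (s + x) - p%:~R * s); last by ring.
by rewrite !sinB; ring.
Qed.

(** Puts a mixed term, taken at the body k, into the form required by
    [sum_cos_roots_unity] and [sum_sin_roots_unity]. *)
Lemma phase_body (R : realType) (N : nat) (m : int) (y t : R) (k : nat) :
  y + m%:~R * (t + 2 * pi * k%:Z%:~R / N%:R)
  = y + m%:~R * t + 2 * pi * m%:~R / N%:R * k%:R.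
Proof. by rewrite -pmulrn; ring. Qed.

(** * Sums over the bodies *)

Section LimaconSums.
Variables (R : realType) (N : nat) (p : int) (a b : R).
Hypotheses (N_gt0 : (0 < N)%N) (pB1 : (p - 1)%:Q / N%:Q \isn't a Num.int).
Let q := limacon p a b.

Lemma body_limaconD (k l : int) t :
  body N q (k + l) t = limacon p a b
    (t + 2 * pi * k%:~R / N%:R + 2 * pi * l%:~R / N%:R).
Proof. by rewrite body_limacon //; congr limacon; rewrite intrD; ring. Qed.

Lemma sum_dot_body (l : int) (t : R) :
  \sum_(k < N) dot (body N q k t) (body N q (k%:Z + l) t)
  = N%:R * (a ^+ 2 * cos (2 * pi * l%:~R / N%:R)
            + b ^+ 2 * cos (2 * pi * p%:~R * l%:~R / N%:R)).
Proof.
under eq_bigr do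
  rewrite body_limaconD [body N q _ t]body_limacon // dot_limacon !phase_body.
rewrite big_split sumr_const card_ord -big_distrr big_split /=.
rewrite !sum_cos_roots_unity // addr0 mulr0 addr0 -[LHS]mulr_natl.
by congr (_ * (_ + _ * cos _)); ring.
Qed.

Lemma sum_cross_body (l : int) (t : R) :
  \sum_(k < N) cross (body N q k t) (body N q (k%:Z + l) t)
  = N%:R * (a ^+ 2 * sin (2 * pi * l%:~R / N%:R)
            + b ^+ 2 * sin (2 * pi * p%:~R * l%:~R / N%:R)).
Proof.
under eq_bigr do
  rewrite body_limaconD [body N q _ t]body_limacon // cross_limacon !phase_body.
rewrite big_split sumr_const card_ord -big_distrr sumrB /=.
rewrite !sum_sin_roots_unity // subrr mulr0 addr0 -[LHS]mulr_natl.
by congr (_ * (_ + _ * sin _)); ring.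
Qed.

Lemma sum_sqr_body (t : R) :
  \sum_(k < N) dot (body N q k t) (body N q k t) = N%:R * (a ^+ 2 + b ^+ 2).
Proof.
have := sum_dot_body 0 t; rewrite !(mulr0, mul0r) cos0 !mulr1 => <-.
by apply: eq_bigr => k _; rewrite addr0.
Qed.

(** Shifting every index by l is the same as moving the time origin by
    2 pi l / N, and the sum does not depend on time. *)
Lemma sum_sqr_bodyD (l : int) (t : R) :
  \sum_(k < N) dot (body N q (k%:Z + l) t) (body N q (k%:Z + l) t)
  = N%:R * (a ^+ 2 + b ^+ 2).
Proof.
rewrite -(sum_sqr_body (t + 2 * pi * l%:~R / N%:R)).
by apply: eq_bigr => k _; rewrite body_limaconD body_limacon // addrAC.
Qed.

End LimaconSums.

Lemma sqr_enorm (R : realType) (u : 'rV[R]_2) : enorm u ^+ 2 = dot u u.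
Proof.
by rewrite sqr_sqrtr // dotE; apply: addr_ge0; rewrite -expr2 sqr_ge0.
Qed.

Lemma sqr_enormD (R : realType) (u v : 'rV[R]_2) :
  enorm (u + v) ^+ 2 = dot u u + dot v v + 2 * dot u v.
Proof. by rewrite sqr_enorm !dotE !mxE; ring. Qed.

Lemma sqr_enormB (R : realType) (u v : 'rV[R]_2) :
  enorm (u - v) ^+ 2 = dot u u + dot v v - 2 * dot u v.
Proof. by rewrite sqr_enorm !dotE !mxE; ring. Qed.

Lemma vplus_limacon (R : realType) (N : nat) (p : int) (a b : R) (l : int) (t : R) :
  (0 < N)%N -> (p - 1)%:Q / N%:Q \isn't a Num.int ->
  vplus N (limacon p a b) l t
  = 2 * N%:R * (a ^+ 2 * (1 + cos (2 * pi * l%:~R / N%:R))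
                + b ^+ 2 * (1 + cos (2 * pi * p%:~R * l%:~R / N%:R))).
Proof.
move=> N_gt0 pB1; rewrite /vplus.
under eq_bigr => k _ do rewrite sqr_enormD.
rewrite !big_split -big_distrr /= sum_sqr_body // sum_sqr_bodyD // sum_dot_body //.
by ring.
Qed.

Lemma vminus_limacon (R : realType) (N : nat) (p : int) (a b : R) (l : int) (t : R) :
  (0 < N)%N -> (p - 1)%:Q / N%:Q \isn't a Num.int ->
  vminus N (limacon p a b) l t
  = 2 * N%:R * (a ^+ 2 * (1 - cos (2 * pi * l%:~R / N%:R))
                + b ^+ 2 * (1 - cos (2 * pi * p%:~R * l%:~R / N%:R))).
Proof.
move=> N_gt0 pB1; rewrite /vminus.
under eq_bigr => k _ do rewrite sqr_enormB.
rewrite sumrB big_split -big_distrr /= sum_sqr_body // sum_sqr_bodyD // sum_dot_body //.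
by ring.
Qed.

(** * The potential energy as a sum over shells *)

Lemma sum_pairs_double (V : zmodType) (N : nat) (g : 'I_N -> 'I_N -> V) :
  (forall j l, g j l = g l j) ->
  (\sum_(j < N) \sum_(l < N | (j < l)%N) g j l) *+ 2
    = \sum_(j < N) \sum_(l < N | l != j) g j l.
Proof.
move=> g_sym; rewrite mulr2n.
rewrite [X in _ + X](exchange_big_dep xpredT) //= -big_split /=.
apply: eq_bigr => j _; rewrite [RHS](bigID (fun l : 'I_N => (j < l)%N)) /=.
congr (_ + _).
  by apply: eq_bigl => l; rewrite -val_eqE /=; case: ltngtP.
apply: eq_big => [l|l _]; last exact: g_sym.
by rewrite -val_eqE /=; case: ltngtP.
Qed.

(** The reflection m -> N - m carries the part m > N/2 onto 1, ..., N/2 when N is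
    odd and onto 1, ..., N/2 - 1 when N is even; in the even case the middle
    term is counted once only. *)
Lemma fold_sum (R : numFieldType) (N : nat) (h : nat -> R) :
  (forall m, (0 < m < N)%N -> h (N - m)%N = h m) ->
  \sum_(1 <= m < N) h m
    = 2 * \sum_(1 <= l < (N./2).+1)
            (if ~~ odd N && (l == N./2) then 2^-1 * h l else h l).
Proof.
move=> h_sym; have [N0|N_gt0] := posnP N.
  by rewrite N0 !big_geq ?mulr0.
have upper : \sum_((N./2).+1 <= m < N) h m = \sum_(1 <= l < N - N./2) h l.
  rewrite -{1}[(N./2).+1]add1n big_addn big_nat_rev /=.
  apply: eq_big_nat => l /andP[l_gt0 ltlN].
  by rewrite -[RHS]h_sym; [congr h; lia | lia].
rewrite (@big_cat_nat _ _ _ (N./2).+1) ?upper //=; last by lia.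
have [oddN|evenN] := boolP (odd N).
  have -> : (N - N./2 = (N./2).+1)%N by lia.
  by rewrite mulr_natl mulr2n.
have -> : (N - N./2 = N./2)%N by lia.
rewrite !big_nat_recr /= ?eqxx; [|lia|lia].
have -> : \sum_(1 <= l < N./2) (if l == N./2 then 2^-1 * h l else h l)
    = \sum_(1 <= l < N./2) h l.
  by apply: eq_big_nat => l /andP[_ ltlN]; rewrite ltn_eqF.
by field.
Qed.

(** Addition in ['I_n.+1] wraps around modulo n + 1: the ordinary distance is m
    when j + m stays below n + 1 and n + 1 - m otherwise, and the circular
    distance does not distinguish the two. *)
Lemma circ_dist_addZp (n : nat) (j m : 'I_n.+1) :
  circ_dist n.+1 j (j + m : 'I_n.+1)%R = minn m (n.+1 - m).
Proof.
have jmE : nat_of_ord (j + m)%R = ((j + m) %% n.+1)%N by [].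
rewrite /circ_dist jmE; have := ltn_ord j; have := ltn_ord m.
case: (ltnP (j + m) n.+1) => [jm_lt|jm_ge] m_lt j_lt.
  by rewrite modn_small //; lia.
have -> : ((j + m) %% n.+1 = j + m - n.+1)%N.
  by rewrite -{1}(subnK jm_ge) modnDr modn_small //; lia.
by lia.
Qed.

Section Shells.
Variables (R : realType) (n : nat) (q : R -> 'rV[R]_2) (t : R).
Let dist (j l : 'I_n.+1) : R :=
  enorm (body n.+1 q j t - body n.+1 q l t) ^+ 2.

Lemma dist_sym j l : dist j l = dist l j.
Proof.
by rewrite /dist !sqr_enormB dotC [dot (body _ _ j _) _ + _]addrC.
Qed.

Lemma vminus_ord (m : 'I_n.+1) :
  vminus n.+1 q m t = \sum_(k < n.+1) dist k (k + m).
Proof.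
apply: eq_bigr => k _; rewrite /dist; congr (enorm (_ - _) ^+ 2).
by rewrite /body -PoszD modz_nat /= modz_nat modn_mod.
Qed.

(** Read from its other endpoint, a pair of difference m is one of difference
    N - m: reindex by k -> k + m. *)
Lemma vminus_sym (m : nat) :
  (0 < m < n.+1)%N -> vminus n.+1 q (n.+1 - m)%N t = vminus n.+1 q m t.
Proof.
case/andP=> m_gt0 m_lt; pose m' := Ordinal m_lt.
have -> : (n.+1 - m)%N = - m' :> nat by rewrite /= modn_small //; lia.
rewrite vminus_ord (vminus_ord m') (reindex_inj (addIr m')) /=.
by apply: eq_bigr => k _; rewrite addrK dist_sym.
Qed.

Lemma potential_shells (kappa : 'I_n.+1 -> 'I_n.+1 -> R) (kd : nat -> R) :
  ZN_symmetric kappa kd ->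
  potential kappa q t
    = 2^-1 * \sum_(1 <= l < (n.+1./2).+1) kd l * Vshell n.+1 q l t.
Proof.
case=> kappa_sym kappaE; congr (_ * _).
apply: (mulfI (_ : 2 != 0 :> R)); first by rewrite pnatr_eq0.
rewrite mulr_natl sum_pairs_double; last first.
  by move=> j l; rewrite kappa_sym -/(dist j l) dist_sym.
(* h m is the contribution of the ordered pairs of difference m. *)
pose h m := kd (minn m (n.+1 - m)) * vminus n.+1 q m t.
transitivity (\sum_(1 <= m < n.+1) h m).
  transitivity (\sum_(m < n.+1 | m != 0) h m).
    transitivity (\sum_(j < n.+1) \sum_(m < n.+1 | m != 0)
                    kappa j (j + m) * dist j (j + m)).
      apply: eq_bigr => j _; rewrite (reindex_inj (addrI j)) /=.
      by apply: eq_bigl => m; rewrite -subr_eq0 addrAC subrr add0r.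
    rewrite exchange_big /=; apply: eq_bigr => m m0.
    rewrite /h vminus_ord big_distrr /=; apply: eq_bigr => j _.
    rewrite kappaE ?circ_dist_addZp // eq_sym -subr_eq0.
    by rewrite addrAC subrr add0r.
  rewrite big_mkcond big_ord_recl /= add0r big_add1 big_mkord.
  by apply: eq_bigr.
rewrite fold_sum; last first.
  move=> m m_lt; rewrite /h vminus_sym //.
  by congr (kd _ * _); lia.
congr (2 * _); apply: eq_big_nat => l /andP[l_gt0 l_le].
rewrite /h /Vshell; have -> : minn l (n.+1 - l) = l by lia.
by case: ifP => // _; ring.
Qed.

End Shells.

Theorem mainTheorem4 (R : realType) (N : nat) (p : int) (a b : R)
    (hN : (4 <= N)%N)
    (hp : p \notin [:: 0; 1; -1])
    (hp0 : p%:Q / N%:Q \isn't a Num.int)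
    (hpD : (p + 1)%:Q / N%:Q \isn't a Num.int)
    (hpB : (p - 1)%:Q / N%:Q \isn't a Num.int)
    (hab : a * b != 0) :
  let q := limacon p a b in
  (forall (l : int) (t : R),
    [/\ \sum_(k < N) dot (body N q k t) (body N q (k%:Z + l) t)
          = N%:R * (a ^+ 2 * cos (2 * pi * l%:~R / N%:R)
                    + b ^+ 2 * cos (2 * pi * p%:~R * l%:~R / N%:R)),
        \sum_(k < N) cross (body N q k t) (body N q (k%:Z + l) t)
          = N%:R * (a ^+ 2 * sin (2 * pi * l%:~R / N%:R)
                    + b ^+ 2 * sin (2 * pi * p%:~R * l%:~R / N%:R)),
        vplus N q l t
          = 2 * N%:R * (a ^+ 2 * (1 + cos (2 * pi * l%:~R / N%:R))
                        + b ^+ 2 * (1 + cos (2 * pi * p%:~R * l%:~R / N%:R)))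
      & vminus N q l t
          = 2 * N%:R * (a ^+ 2 * (1 - cos (2 * pi * l%:~R / N%:R))
                        + b ^+ 2 * (1 - cos (2 * pi * p%:~R * l%:~R / N%:R)))])
  /\
  (forall (kappa : 'I_N -> 'I_N -> R) (kd : nat -> R),
    ZN_symmetric kappa kd ->
    forall t : R,
      potential kappa q t
        = 2^-1 * \sum_(1 <= l < (N./2).+1) kd l * Vshell N q l t).
Proof.
have N_gt0 : (0 < N)%N by apply: leq_trans hN.
split=> [l t|kappa kd kappa_sym t].
  by split; [exact: sum_dot_body | exact: sum_cross_body
            | exact: vplus_limacon | exact: vminus_limacon].
case: N N_gt0 kappa kappa_sym {hN hp0 hpD hpB} => // n _ kappa.
exact: potential_shells.
Qed.
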